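(* Let $H$ be a matching covered, uniformable hypergraph and let $\delta_H(S)$ be a tight cut of $H$. Then the two tight cut contractions $H_S$ and $H_{\overline S}$ are matching covered and uniformable.
   Context: A hypergraph $H$ has a finite vertex set $V(H)$ and a finite family $E(H)$ of non-empty subsets of $V(H)$, called edges; parallel edges are allowed. A perfect matching of $H$ is a set $M$ of edges such that every vertex lies in exactly one edge of $M$. $H$ is matching covered if it is connected, $|E(H)|\geq 1$, and every edge lies in a perfect matching. $H$ is uniformable if there are $m:V(H)\to\mathbb{Z}_{\geq 1}$ and $r\in\mathbb{Z}$ with $\sum_{v\in e}m(v)=r$ for all $e\in E(H)$. For $S\subseteq V(H)$ put $\overline{S}=V(H)\setminus S$, and let $\delta_H(S)$ be the family of edges meeting both $S$ and $\overline S$. The cut $\delta_H(S)$ is tight if $|M\cap\delta_H(S)|=1$ for every perfect matching $M$ of $H$. Tight cut contractions: let $s,\overline s\notin V(H)$ be new vertices. For $e\in\delta_H(S)$ put $e_s=(e\setminus S)\cup\{s\}$ and $e_{\overline s}=(e\cap S)\cup\{\overline s\}$. Then $H_S$ has vertex set $\{s\}\cup\overline S$ and edges $\{e\in E(H): e\subseteq\overline S\}\cup\{e_s:e\in\delta_H(S)\}$, and $H_{\overline S}$ has vertex set $\{\overline s\}\cup S$ and edges $\{e\in E(H):e\subseteq S\}\cup\{e_{\overline s}:e\in\delta_H(S)\}$ (each $e\in\delta_H(S)$ gives its own edge). *)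

(* Defs.v *)
From HB Require Import structures.
From mathcomp Require Import all_boot all_order all_algebra.

Set Implicit Arguments.
Unset Strict Implicit.
Unset Printing Implicit Defensive.

Import Order.TTheory GRing.Theory Num.Theory.

(* The edges form a family: [edge] is an index type, and two distinct indices
   with the same set [ends] are parallel edges. *)
Record hypergraph := Hypergraph {
  vertex : finType;
  edge : finType;
  ends : edge -> {set vertex};
  ends_neq0 : forall e, ends e != set0
}.

Section Hypergraph.
Variable H : hypergraph.

Definition perfect_matching (M : {set edge H}) : Prop :=
  forall v : vertex H, #|[set e in M | v \in ends e]| = 1%N.

Definition adjacent : rel (vertex H) :=
  fun u v => [exists e : edge H, (u \in ends e) && (v \in ends e)].

Definition connected : Prop := forall u v : vertex H, connect adjacent u v.

Definition matching_covered : Prop :=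
  [/\ connected,
      (1 <= #|edge H|)%N
    & forall e : edge H,
        exists M : {set edge H}, perfect_matching M /\ e \in M].

Definition uniformable : Prop :=
  exists (m : vertex H -> int) (r : int),
    (forall v, 1 <= m v)%R /\
    (forall e : edge H, \sum_(v in ends e) m v = r)%R.

Definition cut (S : {set vertex H}) : {set edge H} :=
  [set e | (ends e :&: S != set0) && (ends e :&: ~: S != set0)].

Definition tight (S : {set vertex H}) : Prop :=
  forall M : {set edge H}, perfect_matching M -> #|M :&: cut S| = 1%N.

End Hypergraph.

Section Contraction.
Variables (H : hypergraph) (S : {set vertex H}).

(* [None] is the new vertex s, [Some v] an old vertex v outside S. *)
Definition contract_vertex : finType := option {v : vertex H | v \in ~: S}.

Definition contract_edge : finType :=
  ({e : edge H | ends e \subset ~: S} + {e : edge H | e \in cut S})%type.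

(* The part e \ S of an edge, seen among the vertices of the contraction. *)
Definition outer_ends (e : edge H) : {set contract_vertex} :=
  [set Some v | v : {v : vertex H | v \in ~: S} & val v \in ends e].

Definition contract_ends (f : contract_edge) : {set contract_vertex} :=
  match f with
  | inl e => outer_ends (val e)
  | inr e => None |: outer_ends (val e)
  end.

Lemma contract_ends_neq0 (f : contract_edge) : contract_ends f != set0.
Proof.
case: f => [[e eS]|e] /=; last by apply/set0Pn; exists None; rewrite setU11.
have /set0Pn[v ve] := ends_neq0 e.
have vS : v \in ~: S by apply: (subsetP eS).
by apply/set0Pn; exists (Some (Sub v vS)); apply: imset_f; rewrite inE SubK.
Qed.

Definition contraction : hypergraph := Hypergraph contract_ends_neq0.

End Contraction.

Lemma cutC (H : hypergraph) (S : {set vertex H}) : cut (~: S) = cut S.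
Proof. by apply/setP => e; rewrite !inE setCK andbC. Qed.

(* Main.v *)
Require Import Defs.
From mathcomp Require Import all_boot all_order all_algebra.

(** Let [m] have constant sum [r] on edges.  If [f] is a cut edge and [M] a
    perfect matching through [f], every other edge of [M] lies inside [S] or
    avoids [S], so [m(f :&: S)] is congruent to [m(S)] modulo [r]; since it lies
    strictly between [0] and [r], it is the same number for all cut edges.
    Giving the new vertex this weight makes the contraction uniformable.
    Perfect matchings of [H] restrict to perfect matchings of the contraction:
    the new vertex is covered exactly once because the cut is tight. *)

Set Implicit Arguments.
Unset Strict Implicit.
Unset Printing Implicit Defensive.

Import Order.TTheory GRing.Theory Num.Theory.
Local Open Scope ring_scope.

Section Hypergraph.
Variables (H : hypergraph) (S : {set vertex H}).

(** Both tight cut contractions are instances of [contraction], for [S] and for [~: S]; by this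
    symmetry it suffices to treat the first. *)
Lemma tightC : tight S -> tight (~: S).
Proof. by move=> tS M pM; rewrite cutC tS. Qed.

Lemma edge_subset_cut (e : edge H) :
  [|| ends e \subset S, ends e \subset ~: S | e \in cut S].
Proof.
rewrite inE -!setD_eq0 !setDE setCK orbA orbC.
by case: (ends e :&: S =P set0) => //= _; rewrite ?orbT //; case: eqP.
Qed.

Lemma subsetC_notin_cut (e : edge H) : ends e \subset ~: S -> e \notin cut S.
Proof. by rewrite inE -setD_eq0 setDE setCK => ->. Qed.

Lemma tight_cut_neq0 :
  matching_covered H -> tight S -> exists f : edge H, f \in cut S.
Proof.
move=> [_ /card_gt0P[e _] cov] tS; have [M [/tS cM _]] := cov e.
have /card_gt0P[f] : (0 < #|M :&: cut S|)%N by rewrite cM.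
by rewrite inE => /andP[_ fS]; exists f.
Qed.

(** After exchanging the two sums, each vertex of [S] is counted once, by the one edge of [M] that
    contains it. *)
Lemma perfect_matching_sum (m : vertex H -> int) (M : {set edge H}) :
  perfect_matching M ->
  \sum_(v in S) m v = \sum_(e in M) \sum_(v in ends e :&: S) m v.
Proof.
move=> pM; under [RHS]eq_bigr do under eq_bigl do rewrite inE andbC.
rewrite (exchange_big_dep (mem S)) /=; last by move=> e v _ /andP[].
apply: eq_bigr => v vS; under eq_bigl do rewrite vS /=.
have -> : \sum_(e in M | v \in ends e) m v
        = \sum_(e in [set e in M | v \in ends e]) m v.
  by apply: eq_bigl => e; rewrite inE.
by rewrite sumr_const pM.
Qed.

Section Uniform.
Variables (m : vertex H -> int) (r : int).
Hypotheses (m_ge1 : forall v, 1 <= m v)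
           (m_sum : forall e : edge H, \sum_(v in ends e) m v = r).

Lemma weight_gt0 (A : {set vertex H}) : A != set0 -> 0 < \sum_(v in A) m v.
Proof.
move=> /set0Pn[v vA]; rewrite (bigD1 v) //=; apply: ltr_pwDl.
  exact: lt_le_trans (m_ge1 v).
by apply: sumr_ge0 => w _; apply: le_trans (m_ge1 w).
Qed.

Lemma weight_splitS (e : edge H) :
  r = \sum_(v in ends e :&: S) m v + \sum_(v in ends e :&: ~: S) m v.
Proof. by rewrite -(m_sum e) (big_setID S) setDE. Qed.

Lemma dvdz_cut_weight (M : {set edge H}) (f : edge H) :
  perfect_matching M -> tight S -> f \in M -> f \in cut S ->
  (r %| \sum_(v in S) m v - \sum_(v in ends f :&: S) m v)%Z.
Proof.
move=> pM tS fM fS; rewrite (perfect_matching_sum m pM) (bigD1 f fM) /=.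
rewrite addrAC subrr add0r; apply: rpred_sum => e /andP[eM ef].
case/or3P: (edge_subset_cut e) => eS.
- by rewrite (setIidPl eS) m_sum dvdzz.
- rewrite -setD_eq0 setDE setCK in eS.
  by rewrite (eqP eS) big_set0 dvdz0.
(* By tightness [M :&: cut S] is a singleton, so a second cut edge [e] of [M] would equal [f]. *)
have /eqP/cards1P[g cg] := tS M pM.
have : e \in [set g] by rewrite -cg in_setI eS andbT.
have : f \in [set g] by rewrite -cg in_setI fM.
by move=> /set1P fg /set1P eg; rewrite eg fg eqxx in ef.
Qed.

Lemma cut_weight_const (f g : edge H) :
  matching_covered H -> tight S -> f \in cut S -> g \in cut S ->
  \sum_(v in ends f :&: S) m v = \sum_(v in ends g :&: S) m v.
Proof.
move=> [_ _ cov] tS.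
(* The common value is the residue of [m(S)] modulo [r], which does not mention the cut edge. *)
suff modE h : h \in cut S ->
    \sum_(v in ends h :&: S) m v = ((\sum_(v in S) m v)%R %% r)%Z.
  by move=> /modE-> /modE->.
move=> hS; have [M [pM hM]] := cov h.
have := dvdz_cut_weight pM tS hM hS; rewrite -eqz_mod_dvd => /eqP->.
move: hS; rewrite inE => /andP[/weight_gt0 h1 /weight_gt0 h2].
(* The part of [h] outside [S] has positive weight, so the part inside weighs less than [r] and is
   its own residue. *)
by rewrite modz_small ?(ltW h1) // (weight_splitS h) ltrDl.
Qed.

End Uniform.

Definition old_edge (f : edge (contraction S)) : edge H :=
  match f with inl e => val e | inr e => val e end.

(** With [old_edge_surj] this identifies the edges of the contraction with the edges of [H] that
    meet [~: S], so matchings can be counted in [H]. An edge avoiding [S] is not a cut edge, so the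
    two summands do not overlap. *)
Lemma old_edge_inj : injective old_edge.
Proof.
move=> [[e eS]|[e eS]] [[f fS]|[f fS]] /= ef; rewrite -?ef in fS *.
- by congr inl; apply: val_inj.
- by case/negP: (subsetC_notin_cut eS).
- by case/negP: (subsetC_notin_cut fS).
- by congr inr; apply: val_inj.
Qed.

Lemma old_edge_surj (e : edge H) :
  ends e :&: ~: S != set0 -> exists f, old_edge f = e.
Proof.
rewrite -setDE setD_eq0 => eS.
case/or3P: (edge_subset_cut e) => eS'; first by rewrite eS' in eS.
- by exists (inl (exist _ e eS')).
- by exists (inr (exist _ e eS')).
Qed.

Lemma mem_outer_ends (e : edge H) (v : {v : vertex H | v \in ~: S}) :
  (Some v \in outer_ends S e) = (val v \in ends e).
Proof.
apply/imsetP/idP => [[w]|ve]; first by rewrite inE => we [->].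
by exists v; rewrite ?inE.
Qed.

Lemma None_outer_ends (e : edge H) : None \in outer_ends S e = false.
Proof. by apply/imsetP => -[]. Qed.

Lemma mem_contract_ends_Some f (v : {v : vertex H | v \in ~: S}) :
  (Some v \in ends (f : edge (contraction S))) = (val v \in ends (old_edge f)).
Proof. by case: f => e /=; rewrite ?in_setU1 ?orFb mem_outer_ends. Qed.

Lemma mem_contract_ends_None (f : edge (contraction S)) :
  (None \in ends f) = (old_edge f \in cut S).
Proof.
case: f => [[e eS]|[e eS]] /=; last by rewrite setU11 eS.
by rewrite None_outer_ends (negPf (subsetC_notin_cut eS)).
Qed.

Lemma perfect_matching_contraction (M : {set edge H}) :
  perfect_matching M -> tight S ->
  perfect_matching (old_edge @^-1: M).
Proof.
move=> pM tS v; rewrite -(card_imset _ old_edge_inj).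
case: v => [v|].
  rewrite -(pM (val v)); apply: eq_card => e; apply/imsetP/idP.
    by move=> [f]; rewrite !inE mem_contract_ends_Some => fM ->.
  rewrite inE => /andP[eM ve].
  have /old_edge_surj[f fe] : ends e :&: ~: S != set0.
    by apply/set0Pn; exists (val v); rewrite inE ve (valP v).
  by exists f; rewrite // !inE mem_contract_ends_Some fe eM.
(* At the new vertex, the edges to count are those of [M :&: cut S]. *)
rewrite -(tS M pM); apply: eq_card => e; apply/imsetP/idP.
  by move=> [f]; rewrite in_set mem_contract_ends_None in_setI inE => fM ->.
rewrite in_setI => /andP[eM eS].
have /old_edge_surj[f fe] : ends e :&: ~: S != set0.
  by move: eS; rewrite inE => /andP[].
by exists f; rewrite // in_set mem_contract_ends_None inE fe eM.
Qed.

(* [insub] sends the vertices of [S] to the new vertex [None] and every other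
   vertex to itself. *)
Definition contract_map (v : vertex H) : vertex (contraction S) := insub v.

(** A vertex of [S] on a surviving edge forces that edge to be a cut edge, which contains the new
    vertex. *)
Lemma mem_contract_map (v : vertex H) (f : edge (contraction S)) :
  v \in ends (old_edge f) -> contract_map v \in ends f.
Proof.
rewrite /contract_map; case: insubP => [w _ <-|vS ve].
  by rewrite mem_contract_ends_Some.
rewrite mem_contract_ends_None; move: vS; rewrite inE negbK => vS.
have veS : ends (old_edge f) :&: S != set0.
  by apply/set0Pn; exists v; rewrite inE ve.
case: f ve veS => [[e eS]|[e eS]] //= ve _.
by have := subsetP eS _ ve; rewrite inE vS.
Qed.

(** A path of [H] is mapped step by step to a walk in the contraction. Non-emptiness of [S] makes
    the new vertex an image. *)
Lemma connected_contraction :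
  S != set0 -> connected H -> connected (contraction S).
Proof.
move=> /set0Pn[s sS] cH.
have surj x : exists v, contract_map v = x.
  case: x => [v|]; first by exists (val v); rewrite /contract_map valK.
  by exists s; rewrite /contract_map insubF // inE sS.
suff conn u v : connect (@adjacent H) u v ->
    connect (@adjacent (contraction S)) (contract_map u) (contract_map v).
  by move=> x y; have [u <-] := surj x; have [v <-] := surj y; apply/conn/cH.
move=> /connectP[p pth ->]; elim: p u pth => //= w p IHp u /andP[uw /IHp].
apply: connect_trans; case/existsP: uw => e /andP[ue we].
(* An edge inside [S] is lost, but both endpoints of the step become [None], so the walk stays in
   place. *)
have [eS|/old_edge_surj[f fe]] := eqVneq (ends e :&: ~: S) set0.
  have inS x : x \in ends e -> contract_map x = None.
    move=> xe; rewrite /contract_map insubF //; apply: contraFF (in_set0 x).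
    by rewrite -eS in_setI xe.
  by rewrite !inS.
apply: connect1; apply/existsP; exists f.
by rewrite !mem_contract_map ?fe.
Qed.

Lemma matching_covered_contraction :
  matching_covered H -> tight S -> matching_covered (contraction S).
Proof.
move=> mcH tS; have [f fS] := tight_cut_neq0 mcH tS.
have [cH _ cov] := mcH; split.
- apply: connected_contraction => //; move: fS; rewrite inE => /andP[+ _].
  by apply: contraNneq => ->; rewrite setI0.
- by apply/card_gt0P; exists (inr (exist _ f fS)).
move=> g; have [M [pM gM]] := cov (old_edge g).
exists (old_edge @^-1: M); split; last by rewrite inE.
exact: perfect_matching_contraction.
Qed.

(** Both index sets are injective images, under [Some] and [val], of one set in the subtype of
    vertices outside [S]. *)
Lemma sum_outer_ends (m : vertex H -> int) (m' : vertex (contraction S) -> int)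
    (e : edge H) :
  (forall v, m' (Some v) = m (val v)) ->
  \sum_(x in outer_ends S e) m' x = \sum_(v in ends e :&: ~: S) m v.
Proof.
move=> m'E; rewrite big_imset /=; last by move=> ? ? _ _ [].
under eq_bigr do rewrite m'E.
have -> : ends e :&: ~: S
        = val @: [set v : {v : vertex H | v \in ~: S} | val v \in ends e].
  apply/setP => v; apply/idP/imsetP => [|[w]].
    by rewrite in_setI => /andP[ve vS]; exists (exist _ v vS); rewrite ?inE.
  by rewrite inE => we ->; rewrite in_setI we (valP w).
rewrite big_imset /=; last by move=> ? ? _ _ /val_inj.
by apply: eq_bigl => v; rewrite inE.
Qed.

Lemma uniformable_contraction :
  matching_covered H -> tight S -> uniformable H ->
  uniformable (contraction S).
Proof.
move=> mcH tS [m [r [m_ge1 m_sum]]]; have [f fS] := tight_cut_neq0 mcH tS.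
(* The cut edge [f] is arbitrary: by [cut_weight_const] every cut edge gives the new vertex the same
   weight. *)
pose m' (x : vertex (contraction S)) :=
  if x is Some v then m (val v) else \sum_(v in ends f :&: S) m v.
exists m', r; split=> [[v|]|[[e eS]|[e eS]]] /=; first exact: m_ge1.
- by rewrite -gtz0_ge1 weight_gt0 //; move: fS; rewrite inE => /andP[].
- by rewrite (@sum_outer_ends m) // (setIidPl eS).
rewrite big_setU1 ?None_outer_ends //= (@sum_outer_ends m) //.
by rewrite (cut_weight_const m_ge1 m_sum mcH tS fS eS) -(weight_splitS m_sum).
Qed.

End Hypergraph.

Theorem corollary1p9 (H : hypergraph) (S : {set vertex H}) :
  matching_covered H -> uniformable H -> tight S ->
  (matching_covered (contraction S) /\ uniformable (contraction S)) /\
  (matching_covered (contraction (~: S)) /\ uniformable (contraction (~: S))).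
Proof.
move=> mcH uH tS; have tSC := tightC tS.
by split; split;
  [exact: matching_covered_contraction | exact: uniformable_contraction
  | exact: matching_covered_contraction | exact: uniformable_contraction].
Qed.
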